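(* Let $n\in\mathbb{N}$, $n\ge5$, and let $G$ be a subgroup of $\operatorname{Aut}(W_n)$. Then, for every $\lambda\in\mathbb{N}$ and $\mu\in\{0,\dots,\lambda\}$, we have $$OP_{W_n,G}(\lambda,\mu)=\mu\,OP_{\Gamma_{n-1},G}(\lambda-1,\mu-1)+(\lambda-\mu)\,OP_{\Gamma_{n-1},G}(\lambda,\mu).$$
   Context: $\mathbb{N}$ denotes the positive integers. $\Gamma_{n-1}$ is the cycle of length $n-1$ (on $n-1$ vertices), and the wheel $W_n$ on $n$ vertices is the join of a single vertex $K_1$ (the central vertex) with $\Gamma_{n-1}$. $\operatorname{Aut}(\Gamma)$ is the automorphism group of a graph $\Gamma$, viewed as a group of permutations of the vertices. For $n\ge5$, $\operatorname{Aut}(W_n)\cong\operatorname{Aut}(\Gamma_{n-1})$ by restriction to the vertices of the cycle, and a subgroup $G$ of $\operatorname{Aut}(W_n)$ is identified in this way with a subgroup of $\operatorname{Aut}(\Gamma_{n-1})$. A $\lambda$-coloring of $\Gamma$ is a map $f$ from the vertex set of $\Gamma$ to $\{1,\dots,\lambda\}$; it is $\mu$-proper if for every pair of adjacent vertices $v,w$, either $f(v)\ne f(w)$ or $f(v)=f(w)>\mu$. For a subgroup $G$ of $\operatorname{Aut}(\Gamma)$, $OP_{\Gamma,G}(\lambda,\mu)$ is the number of equivalence classes of $\mu$-proper $\lambda$-colorings of $\Gamma$, where $f$ and $f'$ are equivalent if $f'=f\circ g$ for some $g\in G$. For fixed $\Gamma$ and $G$, $OP_{\Gamma,G}(\lambda,\mu)$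 is a polynomial in $\lambda$ and $\mu$, and is evaluated as such at arguments outside $\lambda\ge1$, $0\le\mu\le\lambda$ (in particular the first summand on the right-hand side is $0$ when $\mu=0$). *)

(* Defs.v *)
From mathcomp Require Import all_boot all_order all_algebra all_fingroup.

Set Implicit Arguments.
Unset Strict Implicit.
Unset Printing Implicit Defensive.

Import GRing.Theory Num.Theory.
Local Open Scope nat_scope.

Record sgraph := SGraph {
  vertex :> finType;
  adj : rel vertex;
  adj_sym : symmetric adj;
  adj_irr : irreflexive adj }.

Definition graph_aut (X : sgraph) : {set {perm X}} :=
  [set g : {perm X} | [forall v, forall w, adj (g v) (g w) == adj v w]].

(* [ordS i] is [i + 1] modulo [n]; for [n >= 3] this is the n-cycle. *)
Definition cycle_adj n : rel 'I_n :=
  fun i j => (i != j) && ((j == ordS i) || (i == ordS j)).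

Lemma cycle_adj_sym n : symmetric (@cycle_adj n).
Proof. by move=> i j; rewrite /cycle_adj eq_sym orbC. Qed.

Lemma cycle_adj_irr n : irreflexive (@cycle_adj n).
Proof. by move=> i; rewrite /cycle_adj eqxx. Qed.

Definition cycle_graph n := SGraph (@cycle_adj_sym n) (@cycle_adj_irr n).

Definition K1 : sgraph :=
  @SGraph unit (fun _ _ => false) (fun _ _ => erefl) (fun _ => erefl).

Section Join.

Variables X Y : sgraph.

Definition join_adj : rel (X + Y)%type := fun u v =>
  match u, v with
  | inl x, inl x' => adj x x'
  | inr y, inr y' => adj y y'
  | _, _ => true
  end.

Lemma join_adj_sym : symmetric join_adj.
Proof. by move=> [x|y] [x'|y'] //=; apply: adj_sym. Qed.

Lemma join_adj_irr : irreflexive join_adj.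
Proof. by move=> [x|y] /=; apply: adj_irr. Qed.

Definition join_graph := SGraph join_adj_sym join_adj_irr.

End Join.

Definition wheel n := join_graph K1 (cycle_graph n.-1).

Definition hub n : wheel n := inl tt.

(* Restriction of permutations of the wheel to its rim. It is only meaningful *)
(* on the stabiliser of the hub (elsewhere the value is junk), and it is a    *)
(* morphism on that stabiliser, which contains the automorphism group of the  *)
(* wheel as soon as [n >= 5] ([graph_aut_wheel_hub]).                         *)
Section Rim.

Variable n : nat.

Definition rim_restr (g : {perm wheel n}) : {perm cycle_graph n.-1} :=
  insubd (1%g : {perm cycle_graph n.-1})
    [ffun v : cycle_graph n.-1 => if g (inr v) is inr w then w else v].

Lemma rim_restrE (g : {perm wheel n}) v :
  g (hub n) = hub n -> inr (rim_restr g v) = g (inr v).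
Proof.
move=> ghub.
have E (u : cycle_graph n.-1) :
    inr (if g (inr u) is inr w then w else u) = g (inr u).
  case Eu: (g (inr u)) => [[]|//].
  by have /perm_inj: g (inr u) = g (hub n) by rewrite ghub.
have inj : injectiveb
    [ffun u : cycle_graph n.-1 => if g (inr u) is inr w then w else u].
  apply/injectiveP => u u'; rewrite !ffunE => Euu'.
  by have /perm_inj [] : g (inr u) = g (inr u') by rewrite -!E Euu'.
by rewrite -pvalE /rim_restr -[pval _]/(val _) insubdK // ffunE.
Qed.

Lemma rim_restr_morph :
  {in 'C[hub n | 'P]%g &, {morph rim_restr : g h / (g * h)%g}}.
Proof.
move=> g h /astab1P gh /astab1P hh; apply/permP => v.
have {}gh : g (hub n) = hub n := gh; have {}hh : h (hub n) = hub n := hh.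
have ghh: (g * h)%g (hub n) = hub n by rewrite permM gh hh.
by apply: (@inr_inj unit); rewrite permM !rim_restrE // permM.
Qed.

Canonical rim_restr_morphism := Morphism rim_restr_morph.

Lemma graph_aut_wheel_hub :
  5 <= n -> graph_aut (wheel n) \subset 'C[hub n | 'P]%g.
Proof.
move=> n5; apply/subsetP => g; rewrite inE => /'forall_forallP /= gA.
apply/astab1P; rewrite /= /aperm; case E: (g (hub n)) => [[]|r] //.
have card3 (T : finType) (a b c : T) : #|[set a; b; c]| <= 3.
  by rewrite setUC cardsU1 cards2; case: (_ \in _); case: (_ != _).
pose B : {set wheel n} :=
  [set hub n; inr (ordS (r : 'I_n.-1)); inr (ord_pred (r : 'I_n.-1))].
have : #|[set g w | w in [set~ hub n]]| <= 3.
  apply: leq_trans (card3 _ _ _ _); apply/subset_leq_card.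
  apply/(subset_trans _ (subxx B))/subsetP => _ /imsetP[w wh ->].
  have /eqP := gA (hub n) w; rewrite E; move: wh; rewrite !inE.
  case: w => [[]|w] _ //; rewrite [X in _ = X]/=.
  case: (g (inr w)) => [[]|s] //= /andP[_ /orP[]/eqP ->].
    by rewrite eqxx.
  by rewrite ordSK eqxx orbT.
rewrite card_imset; last exact: perm_inj.
rewrite cardsC1 card_sum card_unit card_ord add1n /= leqNgt.
by rewrite -ltnS prednK ?n5 //; apply: leq_trans n5.
Qed.

End Rim.

Section OrbitalPolynomial.

Variables (X : sgraph) (G : {group {perm X}}).

(* The element [i] of ['I_l] stands for the colour [i.+1] of {1, ..., l}. *)
Definition proper_coloring l m (f : {ffun X -> 'I_l}) : bool :=
  [forall v, forall w, adj v w ==> (f v != f w) || (m < (f v).+1)].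

Definition coloring_equiv l (f f' : {ffun X -> 'I_l}) : bool :=
  [exists g in G, f' == [ffun v => f ((g : {perm X}) v)]].

Definition OP_count l m : nat :=
  #|equivalence_partition (@coloring_equiv l) [set f | @proper_coloring l m f]|.

(* Polynomiality of [OP_count]: propriety of a colouring and the size of its  *)
(* class only depend on its kernel (given as an idempotent function) and on   *)
(* the set of vertices with a colour at most [m]; each such pattern is that   *)
(* of m ^_ a * (l - m) ^_ b colourings.                                       *)
Let pattern := ({ffun X -> X} * {set X})%type.

Definition kern l (f : {ffun X -> 'I_l}) : {ffun X -> X} :=
  [ffun v => odflt v [pick w | f w == f v]].

Lemma kernK l (f : {ffun X -> 'I_l}) v : f (kern f v) = f v.
Proof. by rewrite ffunE; case: pickP => //= w /eqP. Qed.

Lemma kern_eq l (f : {ffun X -> 'I_l}) v w :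
  (kern f v == kern f w) = (f v == f w).
Proof.
apply/eqP/eqP => [E|E]; first by rewrite -kernK E kernK.
rewrite !ffunE E; case: pickP => //= /(_ w); by rewrite eqxx.
Qed.

Lemma coloring_equiv_rel l : equivalence_rel (@coloring_equiv l).
Proof.
have refl : reflexive (@coloring_equiv l).
  move=> f; apply/exists_inP; exists 1%g; first exact: group1.
  by apply/eqP/ffunP => v; rewrite ffunE perm1.
have symm f f' : coloring_equiv f f' -> coloring_equiv f' f.
  case/exists_inP=> g gG /eqP ->; apply/exists_inP; exists g^-1%g.
    by rewrite groupV.
  by apply/eqP/ffunP => v; rewrite !ffunE permKV.
have tr f f' f'' : coloring_equiv f f' -> coloring_equiv f' f'' ->
    coloring_equiv f f''.
  case/exists_inP=> g gG /eqP -> /exists_inP[h hG /eqP ->].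
  apply/exists_inP; exists (h * g)%g; first exact: groupM.
  by apply/eqP/ffunP => v; rewrite !ffunE permM.
move=> f f' f''; split=> // ff'; apply/idP/idP; last exact: tr.
exact/tr/symm.
Qed.


Lemma equiv_proper_on l m :
  {in [set f | @proper_coloring l m f] & &, equivalence_rel (@coloring_equiv l)}.
Proof. by move=> f f' f'' _ _ _; apply: coloring_equiv_rel. Qed.

Definition small l m (f : {ffun X -> 'I_l}) : {set X} := [set v | f v < m].

Definition pat l m (f : {ffun X -> 'I_l}) : pattern := (kern f, small m f).

Let pproper (p : pattern) (g : {perm X}) : bool :=
  [forall v, forall w, adj v w ==>
    (p.1 (g v) != p.1 (g w)) || (g v \notin p.2)].

Lemma pproperP l m (f : {ffun X -> 'I_l}) (g : {perm X}) :
  proper_coloring m [ffun v => f (g v)] = pproper (pat m f) g.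
Proof.
apply: eq_forallb => v; apply: eq_forallb => w.
by rewrite /= kern_eq inE -leqNgt !ffunE.
Qed.

Let fibre (p : pattern) (g : {perm X}) : {set {perm X}} :=
  [set h : {perm X} | [forall v, p.1 (h v) == p.1 (g v)]].

Let pclass (p : pattern) : nat :=
  #|[set fibre p g | g in [set g in G | pproper p g]]|.

Lemma pclassE l m (f : {ffun X -> 'I_l}) :
  #|[set f' in [set f | proper_coloring m f] | coloring_equiv f f']|
    = pclass (pat m f).
Proof.
pose a (f' : {ffun X -> 'I_l}) : {set {perm X}} :=
  [set h : {perm X} | [forall v, f (h v) == f' v]].
have aE (g : {perm X}) : a [ffun v => f (g v)] = fibre (pat m f) g.
  apply/setP => h; rewrite !inE; apply: eq_forallb => v.
  by rewrite /= kern_eq ffunE.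
have -> : [set f' in [set f | proper_coloring m f] | coloring_equiv f f']
  = [set [ffun v => f (g v)] | g : {perm X} in
       [set g in G | pproper (pat m f) g]].
  apply/setP => f'; rewrite !inE; apply/andP/imsetP.
    case=> pf' /exists_inP[g gG /eqP ef']; exists g => //.
    by rewrite inE gG -pproperP -ef'.
  case=> g; rewrite inE -pproperP => /andP[gG pg] ->; split => //.
  by apply/exists_inP; exists g.
rewrite -(@card_in_imset _ _ a).
  rewrite -imset_comp; congr #|pred_of_set _|.
  by apply: eq_in_imset => g _ /=; rewrite aE.
move=> _ _ /imsetP[g _ ->] /imsetP[h _ ->] E.
have : g \in a [ffun v => f (h v)].
  by rewrite -E inE; apply/forallP => v; rewrite ffunE.
rewrite inE => /forallP gh; apply/ffunP => v.
by have /eqP := gh v; rewrite !ffunE.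
Qed.

Local Open Scope ring_scope.

Lemma OP_count_sum l m :
  (OP_count l m)%:R = \sum_(p : pattern | pproper p 1%g)
    #|[set f : {ffun X -> 'I_l} | pat m f == p]|%:R / (pclass p)%:R :> rat.
Proof.
pose D := [set f | @proper_coloring l m f].
have partP := equivalence_partitionP (@equiv_proper_on l m).
rewrite -/D in partP.
have DE f : (f \in D) = pproper (pat m f) 1%g.
  rewrite inE -pproperP; congr proper_coloring.
  by apply/ffunP => v; rewrite ffunE perm1.
transitivity (\sum_(f in D) (pclass (pat m f))%:R^-1 : rat).
  rewrite /OP_count -/D -sum1_card natr_sum.
  rewrite -[in RHS](cover_partition partP).
  have [_ tiP nP0] := and3P partP.
  rewrite big_trivIset //=; apply: eq_bigr => A AP.
  have [f fD defA] := imsetP AP.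
  have cA h : h \in A -> pclass (pat m h) = #|A|.
    move=> hA; rewrite -pclassE -/D defA; apply: eq_card => h'.
    move: hA; rewrite defA !inE => /andP[hD fh]; congr (_ && _).
    by have [_ /(_ fh) ->] := coloring_equiv_rel f h h'.
  rewrite (eq_bigr (fun _ => #|A|%:R^-1)) => [|h /cA ->//].
  rewrite sumr_const -[RHS]mulr_natl mulfV // pnatr_eq0 cards_eq0.
  by apply: contraNneq nP0 => <-.
rewrite (partition_big (@pat l m) (fun p => pproper p 1%g)); last first.
  by move=> f; rewrite DE.
apply: eq_bigr => p pp.
rewrite (eq_bigr (fun _ => (pclass p)%:R^-1)) => [|f /andP[_ /eqP->]] //.
rewrite sumr_const -[LHS]mulr_natl; congr (_%:R * _); apply: eq_card => f.
rewrite inE unfold_in DE /=; case: eqP => [->|]; by rewrite ?pp ?andbF.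
Qed.

Let valid (p : pattern) : bool :=
  [forall v, p.1 v == odflt v [pick w | p.1 w == p.1 v]]
  && [forall v, (p.1 v \in p.2) == (v \in p.2)].

Lemma pat_valid l m (f : {ffun X -> 'I_l}) : valid (pat m f).
Proof.
apply/andP; split; apply/forallP => v; last by rewrite /= !inE kernK.
rewrite /= [in X in X == _]ffunE; apply/eqP; congr odflt.
by apply: eq_pick => w; rewrite /= kern_eq.
Qed.

Lemma patP l m (f : {ffun X -> 'I_l}) (p : pattern) : valid p ->
  reflect ((forall v w, (f v == f w) = (p.1 v == p.1 w)) /\
           (forall v, (f v < m)%N = (v \in p.2)))
          (pat m f == p).
Proof.
case: p => k S /andP[/forallP /= kE /forallP /= SE].
apply: (iffP eqP) => [[<- <-]|[fk fS]].
  by split=> [v w|v]; rewrite ?kern_eq // inE.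
congr (_, _); last by apply/setP => v; rewrite inE fS.
apply/ffunP => v; rewrite (eqP (kE v)) ffunE; congr odflt.
by apply: eq_pick => w; rewrite /= fk.
Qed.

Let small_reps (p : pattern) := {v : X | (p.1 v == v) && (v \in p.2)}.
Let big_reps (p : pattern) := {v : X | (p.1 v == v) && (v \notin p.2)}.

Lemma card_pat l m (p : pattern) : (m <= l)%N -> valid p ->
  #|[set f : {ffun X -> 'I_l} | pat m f == p]| =
    (m ^_ #|{: small_reps p}| * (l - m) ^_ #|{: big_reps p}|)%N.
Proof.
move=> le_ml pV.
pose sm := [pred i : 'I_l | (i < m)%N].
have csm : #|sm| = m.
  rewrite -sum1_card; transitivity (\sum_(i < l | (i < m)%N) 1)%N.
    by apply: eq_bigl => i; rewrite !inE.
  by rewrite -(big_ord_widen l (fun=> 1%N) le_ml) sum1_card card_ord.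
have cbg : #|[predC sm]| = (l - m)%N.
  by rewrite -[in RHS](card_ord l) -(cardC sm) csm addKn.
rewrite -[in RHS]cbg -[X in (X ^_ _ * _)%N]csm -!card_inj_ffuns_on -cardsX.
pose F (f : {ffun X -> 'I_l}) :=
  ([ffun x => f (val x)] : {ffun small_reps p -> 'I_l},
   [ffun x => f (val x)] : {ffun big_reps p -> 'I_l}).
pose S1 v d := @exist X (fun w => (p.1 w == w) && (w \in p.2)) v d.
pose S2 v d := @exist X (fun w => (p.1 w == w) && (w \notin p.2)) v d.
have kk v : p.1 (p.1 v) == p.1 v.
  have /andP[/forallP /(_ v) /eqP kE _] := pV.
  suff E : p.1 (odflt v [pick w | p.1 w == p.1 v]) = p.1 v.
    by rewrite -kE in E *; rewrite E.
  by case: pickP => //= w /eqP.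
have kS v : (p.1 v \in p.2) = (v \in p.2).
  by have /andP[_ /forallP /(_ v) /eqP] := pV.
rewrite -(@card_in_imset _ _ F) => [|f f']; last first.
  rewrite !inE => /patP - /(_ pV) [fk fS] /patP - /(_ pV) [fk' fS'] [E1 E2].
  apply/ffunP => v.
  have -> : f v = f (p.1 v) by apply/eqP; rewrite fk eq_sym kk.
  have -> : f' v = f' (p.1 v) by apply/eqP; rewrite fk' eq_sym kk.
  case: (boolP (p.1 v \in p.2)) => h.
    have d : (p.1 (p.1 v) == p.1 v) && (p.1 v \in p.2) by rewrite kk.
    by have := congr1 (fun u : {ffun small_reps p -> 'I_l} => u (S1 _ d)) E1;
      rewrite !ffunE.
  have d : (p.1 (p.1 v) == p.1 v) && (p.1 v \notin p.2) by rewrite kk.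
  by have := congr1 (fun u : {ffun big_reps p -> 'I_l} => u (S2 _ d)) E2;
    rewrite !ffunE.
apply: eq_card => -[f1 f2]; rewrite inE /=; apply/imsetP/andP.
  case=> f; rewrite inE => /patP - /(_ pV) [fk fS] [-> ->]; split.
    rewrite inE; apply/andP; split.
      apply/ffun_onP => -[v /= d]; rewrite ffunE /= inE fS.
      by case/andP: d.
    apply/injectiveP => -[v /= d] [w /= d']; rewrite !ffunE /= => /eqP.
    have /andP[/eqP ev _] := d; have /andP[/eqP ew _] := d'.
    rewrite fk ev ew => /eqP E.
    exact: val_inj.
  rewrite inE; apply/andP; split.
    apply/ffun_onP => -[v /= d]; rewrite ffunE /= !inE fS.
    by case/andP: d.
  apply/injectiveP => -[v /= d] [w /= d']; rewrite !ffunE /= => /eqP.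
  have /andP[/eqP ev _] := d; have /andP[/eqP ew _] := d'.
    rewrite fk ev ew => /eqP E.
  exact: val_inj.
rewrite !inE => -[/andP[/ffun_onP f1m /injectiveP f1i]].
move=> /andP[/ffun_onP f2m /injectiveP f2i].
have d1 v : p.1 v \in p.2 -> (p.1 (p.1 v) == p.1 v) && (p.1 v \in p.2).
  by rewrite kk.
have d2 v : p.1 v \notin p.2 -> (p.1 (p.1 v) == p.1 v) && (p.1 v \notin p.2).
  by rewrite kk.
pose f := [ffun v => match boolP (p.1 v \in p.2) with
  | AltTrue h => f1 (S1 _ (d1 v h))
  | AltFalse h => f2 (S2 _ (d2 v h)) end].
have f1E v (d : (p.1 (p.1 v) == p.1 v) && (p.1 v \in p.2)) :
    f v = f1 (S1 (p.1 v) d).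
  rewrite ffunE; case: {-}_ / boolP => h; first by congr (f1 _); apply: val_inj.
  by case/andP: (d) => _ d'; case: (negP h d').
have f2E v (d : (p.1 (p.1 v) == p.1 v) && (p.1 v \notin p.2)) :
    f v = f2 (S2 (p.1 v) d).
  rewrite ffunE; case: {-}_ / boolP => h; last by congr (f2 _); apply: val_inj.
  by case/andP: (d) => _ d'; case: (negP d' h).
exists f.
  rewrite inE; apply/patP => //; have fS v : (f v < m)%N = (v \in p.2).
    rewrite -kS; case: (boolP (p.1 v \in p.2)) => h.
      by rewrite (f1E v (d1 v h)); have := f1m (S1 _ (d1 v h)); rewrite inE.
    rewrite (f2E v (d2 v h)); have := f2m (S2 _ (d2 v h)).
    by rewrite !inE => /negbTE.
  split=> // v w; apply/eqP/eqP => E.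
    have := fS v; rewrite E fS -(kS v) -(kS w) => Evw.
    case: (boolP (p.1 v \in p.2)) => h; have h' := h; rewrite -Evw in h'.
      move: E; rewrite (f1E v (d1 v h)) (f1E w (d1 w h')) => /f1i E.
      exact: (congr1 val E).
    move: E; rewrite (f2E v (d2 v h)) (f2E w (d2 w h')) => /f2i E.
    exact: (congr1 val E).
  case: (boolP (p.1 v \in p.2)) => h; have h' := h; rewrite E in h'.
    by rewrite (f1E v (d1 v h)) (f1E w (d1 w h')); congr (f1 _); apply: val_inj.
  by rewrite (f2E v (d2 v h)) (f2E w (d2 w h')); congr (f2 _); apply: val_inj.
congr (_, _); apply/ffunP => -[v /= d]; rewrite ffunE /=.
  have vk : p.1 v = v by case/andP: d => /eqP.
  have h : p.1 v \in p.2 by rewrite vk; case/andP: d.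
  by rewrite (f1E v (d1 v h)); congr (f1 _); apply: val_inj; rewrite /= vk.
have vk : p.1 v = v by case/andP: d => /eqP.
have h : p.1 v \notin p.2 by rewrite vk; case/andP: d.
by rewrite (f2E v (d2 v h)); congr (f2 _); apply: val_inj; rewrite /= vk.
Qed.

Lemma prod_ffact (x a : nat) : \prod_(i < a) (x%:R - i%:R) = (x ^_ a)%:R :> rat.
Proof.
elim: a => [|a IH]; first by rewrite big_ord0 ffactn0.
rewrite big_ord_recr /= IH ffactnSr natrM.
have [xa|ax] := leqP a x; first by rewrite natrB.
by rewrite ffact_small // !mul0r.
Qed.

Let fall_small (a : nat) : {poly {poly rat}} :=
  (\prod_(i < a) ('X - i%:R%:P))%:P.

Let fall_big (a : nat) : {poly {poly rat}} :=
  \prod_(i < a) ('X - ('X)%:P - i%:R%:P%:P).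

Lemma OP_poly_sig : {P : {poly {poly rat}} |
  forall l m, (m <= l)%N -> P.[l%:R, m%:R] = (OP_count l m)%:R}.
Proof.
exists (\sum_(p : pattern | pproper p 1%g && valid p)
  (fall_small #|{: small_reps p}| * fall_big #|{: big_reps p}|
   * ((pclass p)%:R^-1)%:P%:P)).
move=> l m le_ml; rewrite OP_count_sum big_mkcondr /= !horner_sum.
apply: eq_bigr => p _; case: ifP => [pV|pNV]; last first.
  rewrite !horner0 (_ : #|_| = 0%N) ?mul0r //.
  apply: eq_card0 => f; rewrite inE; apply: contraFF pNV => /eqP <-.
  exact: pat_valid.
rewrite card_pat // natrM /fall_small /fall_big !hornerM !hornerC.
congr (_ * _ * _).
  by rewrite horner_prod -prod_ffact; apply: eq_bigr => i _; rewrite !hornerE.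
rewrite !horner_prod -prod_ffact; apply: eq_bigr => i _.
by rewrite !hornerE natrB.
Qed.

Lemma OP_poly_uniq (P Q : {poly {poly rat}}) :
  (forall l m, (0 < l)%N -> (m <= l)%N -> P.[l%:R, m%:R] = Q.[l%:R, m%:R]) ->
  P = Q.
Proof.
have vanish (p : {poly rat}) k : (forall l, (k <= l)%N -> p.[l%:R] = 0) -> p = 0.
  move=> p0; apply/eqP; apply: contraT => pn0.
  have := @max_poly_roots _ p [seq i%:R | i <- iota k (size p)] pn0.
  rewrite size_map size_iota ltnn; apply.
    by apply/allP => x /mapP[i]; rewrite mem_iota => /andP[ki _] ->; apply/eqP/p0.
  by rewrite map_inj_uniq ?iota_uniq // => i j /eqP; rewrite eqr_nat => /eqP.
move=> PQ; apply/eqP; rewrite -subr_eq0; apply/eqP/polyP => i; rewrite coef0.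
apply: (@vanish _ 0) => m _.
have /(congr1 (fun q : {poly rat} => q`_i)) :
    map_poly (horner_eval (m%:R : rat)) (P - Q) = 0.
  apply: (@vanish _ m.+1) => l ml.
  have := horner_map (horner_eval (m%:R : rat)) (P - Q) l%:R%:P.
  rewrite /= /horner_eval hornerC => ->.
  have l0 : (0 < l)%N := leq_ltn_trans (leq0n m) ml.
  by rewrite !(hornerD, hornerN) (PQ _ _ l0 (ltnW ml)) subrr.
by rewrite coef_map coef0.
Qed.

(* The outer variable is lambda and the inner one mu. By [OP_poly_sig] and    *)
(* [OP_poly_uniq], this is the only polynomial that agrees with [OP_count]    *)
(* for l >= 1 and 0 <= m <= l.                                                *)
Definition OP_poly : {poly {poly rat}} := sval OP_poly_sig.

Definition OP (x y : rat) : rat := OP_poly.[x, y].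

Lemma OPE l m : (m <= l)%N -> OP l%:R m%:R = (OP_count l m)%:R.
Proof. by move=> le_ml; rewrite /OP /OP_poly; case: OP_poly_sig => P /= ->. Qed.

End OrbitalPolynomial.

Arguments OP X G%_G x y : clear implicits.

(* Main.v *)
Require Import Defs.
From mathcomp Require Import all_boot all_order all_algebra all_fingroup.

Set Implicit Arguments.
Unset Strict Implicit.
Unset Printing Implicit Defensive.

Import GRing.Theory Num.Theory.
Local Open Scope ring_scope.

(** Automorphisms of the wheel fix the hub, so the colour [c] of the hub is an
    invariant of the class of a colouring. For fixed [c], a colouring is proper
    when its rim is and, in case [c <= mu], when the rim moreover avoids [c].
    In that case the rim is coloured with the other [lambda - 1] colours, of
    which [mu - 1] are at most [mu]. *)

Section ClassCounting.

Variables (T : finType) (R : rel T).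

(** Taking images under [phi] is injective on sets and carries the class of [x] in [D] to the class
    of [phi x] in [phi @: D]. *)
Lemma card_equivalence_partition_imset (T' : finType) (R' : rel T')
    (phi : T' -> T) (D : {set T'}) :
  injective phi -> (forall x y, R (phi x) (phi y) = R' x y) ->
  #|equivalence_partition R (phi @: D)| = #|equivalence_partition R' D|.
Proof.
move=> phiI phiR.
rewrite /equivalence_partition -imset_comp.
rewrite -[in RHS](card_imset _ (imset_inj phiI)) -imset_comp.
congr #|pred_of_set _|; apply: eq_in_imset => x _ /=.
apply/setP => y; rewrite !inE; apply/andP/imsetP.
  by case=> /imsetP[z zD ->]; rewrite phiR => xz; exists z; rewrite ?inE ?zD.
by case=> z; rewrite inE => /andP[zD xz] ->; rewrite phiR imset_f.
Qed.

(** As [k] is constant along [R], each class lies in a single level set of [k] and is a whole class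
    there. *)
Lemma card_equivalence_partition_sum (I : finType) (k : T -> I) (D : {set T}) :
  reflexive R -> (forall x y, R x y -> k x = k y) ->
  #|equivalence_partition R D| =
    (\sum_i #|equivalence_partition R [set x in D | k x == i]|)%N.
Proof.
move=> Rr kR; pose F i := equivalence_partition R [set x in D | k x == i].
have FE i A : (A \in F i) =
    [exists x in D, (k x == i) && (A == [set y in D | R x y])].
  have cE x : k x = i ->
      [set y in [set z in D | k z == i] | R x y] = [set y in D | R x y].
    move=> kx; apply/setP => y; rewrite !inE -andbA; congr (_ && _).
    by case xy: (R x y); rewrite ?andbF // -(kR _ _ xy) kx eqxx.
  apply/imsetP/exists_inP => [[x]|[x xD /andP[/eqP kx /eqP ->]]].
    rewrite inE => /andP[xD /eqP kx] ->; exists x => //.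
    by rewrite cE // kx !eqxx.
  by exists x; rewrite ?inE ?xD ?kx ?eqxx // cE.
have -> : equivalence_partition R D = \bigcup_i F i.
  apply/setP => A; apply/imsetP/bigcupP => [[x xD ->]|[i _]].
    by exists (k x); rewrite // FE; apply/exists_inP; exists x; rewrite ?eqxx.
  by rewrite FE => /exists_inP[x xD /andP[_ /eqP ->]]; exists x.
rewrite -sum1_card partition_disjoint_bigcup => [|i j ij]; last first.
  (* By reflexivity [x] lies in its own class; if this is also the class of [y], then [R y x], which
     forces [i = j]. *)
  apply/pred0P => A; apply/andP => -[] /=; rewrite !FE.
  move=> /exists_inP[x xD /andP[/eqP kx /eqP ->]].
  move=> /exists_inP[y yD /andP[/eqP ky /eqP /setP/(_ x)]].
  rewrite !inE xD Rr /= => /esym /kR E.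
  by rewrite -kx -ky E eqxx in ij.
by apply: eq_bigr => i _; rewrite sum1_card.
Qed.

End ClassCounting.

Section WheelColorings.

Variable n : nat.
Hypothesis n_ge5 : (5 <= n)%N.
Variable G : {group {perm wheel n}}.
Hypothesis sGA : G \subset graph_aut (wheel n).

Let C := cycle_graph n.-1.
(** [G] lies in the domain of the morphism, the stabiliser of the hub, so this image consists of the
    restrictions of all elements of [G]. *)
Let H : {group {perm C}} := (rim_restr_morphism n @* G)%G.

Lemma wheel_aut_hub g : g \in G -> g (hub n) = hub n.
Proof.
move=> gG; have := subsetP (subset_trans sGA (graph_aut_wheel_hub n_ge5)) g gG.
by move/astab1P.
Qed.

Section HubColor.

(** [e] enumerates the colours that a hub of colour [c] leaves to the rim: all if [m <= c], all but
    [c] otherwise. Colours start at 0, so [c < m] encodes a colour that is at most mu. *)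
Variables (l k m m' : nat) (c : 'I_l) (e : 'I_k -> 'I_l).
Hypothesis e_inj : injective e.
Hypothesis e_small : forall i, (e i < m)%N = (i < m')%N.
Hypothesis e_codom : forall j, (j \in codom e) = (j != c) || (m <= c)%N.

Definition hub_ext (f : {ffun C -> 'I_k}) : {ffun wheel n -> 'I_l} :=
  [ffun x : wheel n => match x with inl _ => c | inr v => e (f v) end].

Lemma hub_ext_inj : injective hub_ext.
Proof.
move=> f f' /ffunP E; apply/ffunP => v.
by have := E (inr v); rewrite !ffunE => /e_inj.
Qed.

(** Each [g] in [G] fixes the hub and acts on the rim as its restriction; [e] cancels by
    injectivity. *)
Lemma coloring_equiv_hub_ext f f' :
  coloring_equiv G (hub_ext f) (hub_ext f') = coloring_equiv H f f'.
Proof.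
have restrE g : g \in G ->
    (hub_ext f' == [ffun x => hub_ext f ((g : {perm wheel n}) x)])
    = (f' == [ffun v => f (rim_restr g v)]).
  move=> gG; have ghub := wheel_aut_hub gG; apply/eqP/eqP => /ffunP E.
    apply/ffunP => v; have := E (inr v).
    by rewrite !ffunE -(rim_restrE v ghub) => /e_inj.
  apply/ffunP => -[[]|v]; rewrite !ffunE.
    by rewrite -/(hub n) ghub.
  by rewrite -(rim_restrE v ghub) E ffunE.
apply/exists_inP/exists_inP => [[g gG]|[_ /morphimP[g _ gG ->]]].
  rewrite restrE // => E; exists (rim_restr g) => //.
  by apply: mem_morphim => //; apply/astab1P/wheel_aut_hub.
by move=> E; exists g; rewrite ?restrE.
Qed.

(** On rim edges [e] preserves both equality and the threshold; spokes impose nothing, since [e]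
    only takes values allowed next to [c]. *)
Lemma proper_hub_ext f :
  proper_coloring m (hub_ext f) = proper_coloring m' f.
Proof.
have rimE v w : (hub_ext f (inr v) != hub_ext f (inr w))
    || (m < (hub_ext f (inr v)).+1)%N = (f v != f w) || (m' < (f v).+1)%N.
  by rewrite !ffunE (inj_eq e_inj) !ltnS leqNgt e_small -leqNgt.
apply/'forall_forallP/'forall_forallP => /= P v w; last first.
  have cE u : (c != e (f u)) || (m <= c)%N.
    by rewrite eq_sym -e_codom codom_f.
  case: v w => [[]|v] [[]|w]; apply/implyP => //= vw.
  - by rewrite !ffunE ltnS.
  (* Here the threshold is tested at the rim end of the spoke, which matters only if its colour
     equals [c]. *)
  - rewrite !ffunE ltnS; have := cE v; rewrite eq_sym.
    by case: eqVneq => [->|].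
  - by rewrite rimE (implyP (P v w)).
have := P (inr v) (inr w).
by rewrite /= rimE.
Qed.

(** The spokes of a proper colouring force the rim colours into the image of [e], so they can be
    pulled back along [e]. *)
Lemma hub_ext_imset :
  [set f in [set f | @proper_coloring (wheel n) l m f] | f (hub n) == c]
  = hub_ext @: [set f | proper_coloring m' f].
Proof.
apply/setP => f; rewrite !inE; apply/andP/imsetP => [[pf /eqP fc]|[f0]].
  have fe v : f (inr v) \in codom e.
    rewrite e_codom; have /'forall_forallP/(_ (hub n) (inr v)) := pf.
    by rewrite fc /= eq_sym ltnS.
  pose f0 : {ffun C -> 'I_k} := [ffun v => iinv (fe v)].
  have fE : f = hub_ext f0.
    by apply/ffunP => -[[]|v]; rewrite !ffunE ?f_iinv -?fc.
  by exists f0; rewrite // inE -proper_hub_ext -fE.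
by rewrite inE -proper_hub_ext => pf ->; rewrite pf ffunE.
Qed.

Lemma card_hub_color :
  #|equivalence_partition (@coloring_equiv _ G l)
      [set f in [set f | @proper_coloring (wheel n) l m f] | f (hub n) == c]|
  = OP_count H k m'.
Proof.
rewrite hub_ext_imset.
exact: card_equivalence_partition_imset hub_ext_inj coloring_equiv_hub_ext.
Qed.

End HubColor.

Lemma OP_count_wheel l m : (m <= l)%N ->
  OP_count G l m =
    (m * OP_count H l.-1 m.-1 + (l - m) * OP_count H l m)%N.
Proof.
move=> le_ml.
pose hub_color (f : {ffun wheel n -> 'I_l}) := f (hub n).
rewrite [LHS](card_equivalence_partition_sum (k := hub_color)); first 1 last.
- by move=> f; have [] := coloring_equiv_rel G f f f.
- move=> f f' /exists_inP[g gG /eqP ->].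
  by rewrite /hub_color ffunE wheel_aut_hub.
have cm : #|[pred c : 'I_l | (c < m)%N]| = m.
  by rewrite -sum1_card (big_ord_narrow le_ml) sum1_card card_ord.
have cM : #|[pred c : 'I_l | ~~ (c < m)%N]| = (l - m)%N.
  have := cardC [pred c : 'I_l | (c < m)%N].
  by rewrite cm card_ord => /(congr1 (subn^~ m)); rewrite addKn.
rewrite (bigID (fun c : 'I_l => (c < m)%N)) /=.
rewrite -[X in (X * _)%N]cm -[X in _ = (_ + X * _)%N]cM -!sum_nat_const.
congr (_ + _)%N.
  apply: eq_bigr => c.
  case: l le_ml @hub_color c {cm cM} => [_ _ []//|k] le_mk hub_color c cm.
  apply: (card_hub_color (e := lift c)); first exact: lift_inj.
  (* Skipping [c < m] lowers the threshold by one: for [i < c] both inequalities hold, and from [c]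
     on [lift c] adds 1. *)
  - move=> i; rewrite /= /bump; case: m cm {le_mk} => // m' cm.
    by case: (leqP c i) => // ic; rewrite !add0n (leq_trans ic cm) (ltn_trans ic cm).
  - move=> j; rewrite leqNgt cm orbF; apply/codomP/idP => [[i ->]|].
      by rewrite eq_sym neq_lift.
    by rewrite eq_sym => /unlift_some[i -> _]; exists i.
apply: eq_bigr => c; rewrite -leqNgt => mc.
(* A hub colour [c >= m] may be repeated on the rim, so all [l] colours remain. *)
apply: (card_hub_color (e := id)) => // j.
by rewrite mc orbT; apply/codomP; exists j.
Qed.

End WheelColorings.

Theorem theorem12 (n : nat) (n_ge5 : (5 <= n)%N)
    (G : {group {perm wheel n}}) (sGA : G \subset graph_aut (wheel n))
    (lambda mu : nat) (lambda_gt0 : (0 < lambda)%N)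
    (le_mu_lambda : (mu <= lambda)%N) :
  let C := cycle_graph n.-1 in
  let H : {group {perm C}} := (rim_restr_morphism n @* G)%G in
  OP (wheel n) G lambda%:R mu%:R =
    mu%:R * OP C H (lambda%:R - 1) (mu%:R - 1)
    + (lambda%:R - mu%:R) * OP C H lambda%:R mu%:R.
Proof.
move=> C H; rewrite !OPE // (OP_count_wheel n_ge5 sGA) // natrD !natrM.
(* At [mu = 0] the argument [mu - 1] is negative and [OPE] does not apply; there the factor [mu]
   kills the summand. *)
rewrite natrB //; congr (_ + _); case: mu le_mu_lambda => [|mu] le_mu_l.
  by rewrite !mul0r.
have predE k : k.+1%:R - 1 = k%:R :> rat by rewrite mulrSr addrK.
by case: lambda le_mu_l {lambda_gt0} => // l le_mu_l; rewrite !predE OPE.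
Qed.
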